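(* Let $w_1,w_2,w_3\in W$ be such that $\Phi^+$ is the disjoint union $\Phi^+=\Phi(w_1^\vee)\sqcup\Phi(w_2^\vee)\sqcup\Phi(w_3^\vee)$. Then $$d(w_1)+d(w_2)+d(w_3)=2\operatorname{rk}(G)\quad\text{and}\quad d(w_1^\vee)+d(w_2^\vee)+d(w_3^\vee)=\operatorname{rk}(G).$$
   Context: $G$ is a complex semisimple algebraic group of rank $\operatorname{rk}(G)$, $B\subset G$ a Borel subgroup, $T\subset B$ a maximal torus, $W$ the Weyl group, $\Phi$ the roots, $\Phi^+,\Phi^-,\Delta$ the positive, negative and simple roots determined by $B$. For $w\in W$, $\Phi(w)=\Phi^+\cap w^{-1}\Phi^-$, $\ell(w)=\sharp\Phi(w)$ (the Coxeter length), and $w^\vee=w_0w$, where $w_0$ is the longest element of $W$. For $\alpha\in\Delta$, $s_\alpha$ is the corresponding simple reflection. The set of left descents of $w$ is $D(w)=\{\alpha\in\Delta:\ell(s_\alpha w)<\ell(w)\}$, and $d(w)=\sharp D(w)$. *)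

(* Defs.v *)
From HB Require Import structures.
From mathcomp Require Import all_boot all_order all_algebra all_fingroup.

Set Implicit Arguments.
Unset Strict Implicit.
Unset Printing Implicit Defensive.

Import GRing.Theory.
Local Open Scope ring_scope.

(* The character lattice X(T) and the cocharacter lattice of a torus T of     *)
(* dimension n are both identified with Z^n, by dual bases.                   *)
Definition pairing (n : nat) (x y : 'rV[int]_n) : int := (x *m y^T) 0 0.

(* A pair (G, T), with G a connected complex semisimple algebraic group and T *)
(* a maximal torus of G, is encoded by its root datum: a reduced root datum   *)
(* whose roots span X(T) over Q.  By Chevalley's existence and isomorphism    *)
(* theorems every such datum comes from a (G, T), unique up to isomorphism;   *)
(* n = dim T is the rank of G.  The root set Phi is the (injective) family    *)
(* root, indexed by a finite type I, so that subsets of Phi are sets {set I}. *)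
Record semisimple_datum (n : nat) (I : finType) := SemisimpleDatum {
  root : I -> 'rV[int]_n;
  coroot : I -> 'rV[int]_n;
  root_inj : injective root;
  coroot_inj : injective coroot;
  root_coroot2 : forall a, pairing (root a) (coroot a) = 2;
  (* the permutation of Phi induced by s_a; root_refl determines it *)
  refl : I -> {perm I};
  root_refl : forall a b,
    root (refl a b) = root b - pairing (root b) (coroot a) *: root a;
  coroot_refl : forall a b, exists c,
    coroot c = coroot b - pairing (root a) (coroot b) *: coroot a;
  root_reduced : forall (a b : I) (p q : int), q != 0 ->
    q *: root b = p *: root a -> root b = root a \/ root b = - root a;
  root_span : forall x : 'rV[int]_n, exists (m : int) (c : I -> int),
    m != 0 /\ m *: x = \sum_(i : I) c i *: root i
}.

Section WeylGroup.

Variables (n : nat) (I : finType) (D : semisimple_datum n I).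

(* W acts faithfully on Phi because Phi spans X(T) over Q, so W is taken as a *)
(* group of permutations of Phi.                                              *)
Definition weyl : {group {perm I}} := <<[set refl D a | a in I]>>%G.

(* The product of W as a group of maps: (wmul u w) x = u (w x), whereas the   *)
(* product of {perm I} composes from left to right.                           *)
Definition wmul (u w : {perm I}) : {perm I} := (w * u)%g.

(* Borel subgroups B containing T correspond to the sets of positive roots    *)
(* Phi^+ = {a | <a, lambda> > 0}, for lambda a cocharacter of T orthogonal to *)
(* no root.                                                                   *)
Definition positive_system (P : {set I}) : Prop :=
  exists lambda : 'rV[int]_n,
    (forall a, pairing (root D a) lambda != 0) /\
    P = [set a | 0 < pairing (root D a) lambda].

Variable P : {set I}.

Definition neg_roots : {set I} :=
  [set a | [exists b in P, root D a == - root D b]].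

Definition simple_roots : {set I} :=
  [set a in P | ~~ [exists b in P, exists c in P,
                      root D a == root D b + root D c]].

Definition inv_set (w : {perm I}) : {set I} := P :&: w @^-1: neg_roots.

Definition len (w : {perm I}) : nat := #|inv_set w|.

Definition w0 : {perm I} := [arg max_(w > (1%g : {perm I}) in weyl) len w]%N.

Definition wdual (w : {perm I}) : {perm I} := wmul w0 w.

Definition left_descents (w : {perm I}) : {set I} :=
  [set a in simple_roots | (len (wmul (refl D a) w) < len w)%N].

Definition descents (w : {perm I}) : nat := #|left_descents w|.

End WeylGroup.

(* Main.v *)
Require Import Defs.
From mathcomp Require Import all_boot all_order all_algebra all_fingroup.
From mathcomp Require Import ring lra zify.

(* Let u_i = w_i^vee, C the dominant chamber, and consider the four chambers -C,
   u_1^-1 C, u_2^-1 C, u_3^-1 C.  The hypothesis says that every root is positive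
   on exactly two of them, a condition symmetric in the four chambers, and
   d(u_i) is the number of walls (simple roots) of u_i^-1 C that are also
   positive on -C.  Let a_io be the number of simple roots of the i-th chamber
   positive on the o-th (i <> o).  Every row sum of (a_io) is the rank n.  Every
   column sum is at most n, because the simple roots it counts are linearly
   independent: expanding one of them in the simple roots of another chamber, only
   lower roots of the column can occur, so the family is unitriangular.  As the
   total is 4n, every column sum is n; the column of -C is the second equality.
   The first one follows from d(w) + d(w0 w) = n. *)

Set Implicit Arguments.
Unset Strict Implicit.
Unset Printing Implicit Defensive.

Import Order.TTheory GRing.Theory Num.Theory.
Local Open Scope ring_scope.

Definition dot (n : nat) (x y : 'rV[rat]_n) : rat := (x *m y^T) 0 0.

(** * The rational root space *)

Section Dot.
Variable n : nat.
Implicit Types x y z : 'rV[rat]_n.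

Lemma dotE x y : dot x y = \sum_j x 0 j * y 0 j.
Proof. by rewrite /dot mxE; apply: eq_bigr => j _; rewrite mxE. Qed.

Lemma dotC x y : dot x y = dot y x.
Proof. by rewrite !dotE; apply: eq_bigr => j _; rewrite mulrC. Qed.

Lemma dotDl x y z : dot (x + y) z = dot x z + dot y z.
Proof. by rewrite /dot mulmxDl mxE. Qed.

Lemma dotZl c x z : dot (c *: x) z = c * dot x z.
Proof. by rewrite /dot -scalemxAl mxE. Qed.

Lemma dotNl x z : dot (- x) z = - dot x z.
Proof. by rewrite -scaleN1r dotZl mulN1r. Qed.

Lemma dotBl x y z : dot (x - y) z = dot x z - dot y z.
Proof. by rewrite dotDl dotNl. Qed.

Lemma dot0l z : dot 0 z = 0.
Proof. by rewrite /dot mul0mx mxE. Qed.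

Lemma dotNr x z : dot x (- z) = - dot x z.
Proof. by rewrite dotC dotNl dotC. Qed.

Lemma dotBr x y z : dot x (y - z) = dot x y - dot x z.
Proof. by rewrite dotC dotBl !(dotC x). Qed.

Lemma dotZr c x z : dot x (c *: z) = c * dot x z.
Proof. by rewrite dotC dotZl dotC. Qed.

Lemma dot_suml (J : Type) (s : seq J) (A : pred J) (F : J -> 'rV[rat]_n) z :
  dot (\sum_(j <- s | A j) F j) z = \sum_(j <- s | A j) dot (F j) z.
Proof.
by apply: (big_morph (fun x => dot x z) (fun x y => dotDl x y z) (dot0l z)).
Qed.

Lemma dot_mulmxl x y (M : 'M_n) : dot (x *m M) y = dot x (y *m M^T).
Proof. by rewrite /dot trmx_mul trmxK mulmxA. Qed.

Lemma dot_map (x y : 'rV[int]_n) :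
  dot (map_mx intr x) (map_mx intr y) = (pairing x y)%:~R.
Proof. by rewrite /dot map_trmx -map_mxM mxE. Qed.

End Dot.

Section RootDatum.
Variables (n : nat) (I : finType) (D : semisimple_datum n I).
Implicit Types (a b c : I) (x y z : 'rV[rat]_n).

Definition rt a : 'rV[rat]_n := map_mx intr (Defs.root D a).
Definition ct a : 'rV[rat]_n := map_mx intr (coroot D a).
(** Since s_a(a) = -a, this is the negation of roots read on indices. *)
Definition opp a : I := refl D a a.

Lemma map_intr_inj : injective (map_mx intr : 'rV[int]_n -> 'rV[rat]_n).
Proof.
move=> x y /rowP e; apply/rowP => j.
by have := e j; rewrite !mxE => /eqP; rewrite eqr_int => /eqP.
Qed.

Lemma map_intr_add (x y : 'rV[int]_n) :
  map_mx intr (x + y) = map_mx intr x + map_mx intr y :> 'rV[rat]_n.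
Proof. by apply/rowP => j; rewrite !mxE rmorphD. Qed.

Lemma map_intr_opp (x : 'rV[int]_n) :
  map_mx intr (- x) = - map_mx intr x :> 'rV[rat]_n.
Proof. by apply/rowP => j; rewrite !mxE rmorphN. Qed.

Lemma map_intr_scale (k : int) (x : 'rV[int]_n) :
  map_mx intr (k *: x) = k%:~R *: map_mx intr x :> 'rV[rat]_n.
Proof. by apply/rowP => j; rewrite !mxE rmorphM. Qed.

Lemma rt_inj : injective rt.
Proof. by move=> a b /map_intr_inj /root_inj. Qed.

Lemma ct_inj : injective ct.
Proof. by move=> a b /map_intr_inj /coroot_inj. Qed.

Lemma cartan_int a b : exists k : int, dot (rt a) (ct b) = k%:~R.
Proof. by exists (pairing (Defs.root D a) (coroot D b)); rewrite dot_map. Qed.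

Lemma dot_rt_ct a : dot (rt a) (ct a) = 2.
Proof. by rewrite dot_map root_coroot2. Qed.

Lemma rt_refl a b : rt (refl D a b) = rt b - dot (rt b) (ct a) *: rt a.
Proof.
by rewrite /rt root_refl map_intr_add map_intr_opp map_intr_scale dot_map.
Qed.

Lemma rt_opp a : rt (opp a) = - rt a.
Proof. by rewrite rt_refl dot_rt_ct scaler_nat mulr2n opprD addNKr. Qed.

Lemma oppK : involutive opp.
Proof. by move=> a; apply: rt_inj; rewrite !rt_opp opprK. Qed.

Lemma ct_refl a b : exists c, ct c = ct b - dot (rt a) (ct b) *: ct a.
Proof.
have [c ec] := coroot_refl D a b; exists c.
by rewrite /ct ec map_intr_add map_intr_opp map_intr_scale dot_map.
Qed.

Lemma rt_span x : exists e : I -> rat, x = \sum_i e i *: rt i.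
Proof.
have delta j : exists e : I -> rat, delta_mx 0 j = \sum_i e i *: rt i.
  have [m [k [m0 e]]] := root_span D (delta_mx 0 j).
  exists (fun i => (k i)%:~R / m%:~R).
  apply: (scalerI (a := m%:~R)); first by rewrite intr_eq0.
  rewrite -(map_delta_mx (intr : int -> rat)).
  rewrite -map_intr_scale e (big_morph _ map_intr_add (map_mx0 _ _ _)).
  rewrite scaler_sumr.
  apply: eq_bigr => i _; rewrite map_intr_scale scalerA mulrCA divff ?mulr1 //.
  by rewrite intr_eq0.
have [e He] := fin_all_exists delta.
exists (fun i => \sum_j x 0 j * e j i).
rewrite {1}[x]row_sum_delta.
under eq_bigr => j _ do rewrite He scaler_sumr.
rewrite exchange_big; apply: eq_bigr => i _; rewrite scaler_suml.
by apply: eq_bigr => j _; rewrite scalerA.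
Qed.

(** Induction on a product of reflections, each being right multiplication by
    [1%:M - (ct a)^T *m rt a]. Such a factor fixes every vector on which all coroots vanish, whence
    the second clause. *)
Lemma weyl_linear w : w \in weyl D -> exists M : 'M[rat]_n,
  (forall a, rt (w a) = rt a *m M) /\
  (forall x, (forall c, dot x (ct c) = 0) -> x *m M = x).
Proof.
move=> /gen_prodgP [k [c cA ->]].
elim/big_ind: _ => [|u v [M [hM fM]] [N [hN fN]]|i _].
- by exists 1%:M; split=> [a|x _]; rewrite ?perm1 mulmx1.
- exists (M *m N); split=> [a|x hx]; first by rewrite permM hN hM mulmxA.
  by rewrite mulmxA fM // fN.
- have /imsetP [a _ ->] := cA i.
  exists (1%:M - (ct a)^T *m rt a).
  have E x : x *m (1%:M - (ct a)^T *m rt a) = x - dot x (ct a) *: rt a.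
    by rewrite mulmxBr mulmx1 mulmxA [x *m _]mx11_scalar mul_scalar_mx.
  by split=> [b|x hx]; rewrite E ?rt_refl // hx scale0r subr0.
Qed.

Lemma weyl_opp w a : w \in weyl D -> w (opp a) = opp (w a).
Proof.
move=> /weyl_linear [M [hM _]]; apply: rt_inj.
by rewrite rt_opp !hM rt_opp mulNmx.
Qed.

Lemma refl_weyl a : refl D a \in weyl D.
Proof. by apply: mem_gen; apply: imset_f. Qed.

(* Such an x is fixed by W; but averaging over W kills every root, since each
   orbit sum is equal to its own opposite. *)
Lemma coroots_separate x : (forall c, dot x (ct c) = 0) -> x = 0.
Proof.
move=> hx; have [e ex] := rt_span x.
have fix_x w : w \in weyl D -> \sum_i e i *: rt (w i) = x.
  move=> /weyl_linear [M [hM fM]]; rewrite -[RHS]fM // [in RHS]ex mulmx_suml.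
  by apply: eq_bigr => i _; rewrite hM scalemxAl.
have orbit0 i : \sum_(w in weyl D) rt (w i) = 0.
  suff h : \sum_(w in weyl D) rt (w i) = - \sum_(w in weyl D) rt (w i).
    apply/eqP; move/eqP: h; rewrite -addr_eq0 -mulr2n -scaler_nat scaler_eq0.
    by rewrite pnatr_eq0.
  rewrite {1}(reindex_inj (mulgI (refl D i))) -sumrN /=.
  apply: eq_big => [w|w]; rewrite groupMl ?refl_weyl // => ww.
  by rewrite permM weyl_opp // rt_opp.
apply/eqP; have : #|weyl D|%:R *: x = 0.
  rewrite scaler_nat -sumr_const.
  rewrite (eq_bigr (fun w : {perm I} => \sum_i e i *: rt (w i)));
    last by move=> w /fix_x.
  rewrite exchange_big big1 // => i _; rewrite -scaler_sumr orbit0 scaler0 //.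
move/eqP; rewrite scaler_eq0 pnatr_eq0 => /orP[|//].
by rewrite eqn0Ngt cardG_gt0.
Qed.

(** * The Weyl-invariant inner product on the root space *)

Definition form x y : rat := \sum_c dot x (ct c) * dot y (ct c).

Lemma formC x y : form x y = form y x.
Proof. by apply: eq_bigr => c _; rewrite mulrC. Qed.

Lemma formDl x y z : form (x + y) z = form x z + form y z.
Proof. by rewrite -big_split; apply: eq_bigr => c _; rewrite dotDl mulrDl. Qed.

Lemma formZl k x z : form (k *: x) z = k * form x z.
Proof. by rewrite mulr_sumr; apply: eq_bigr => c _; rewrite dotZl mulrA. Qed.

Lemma formNl x z : form (- x) z = - form x z.
Proof. by rewrite -scaleN1r formZl mulN1r. Qed.

Lemma formBl x y z : form (x - y) z = form x z - form y z.
Proof. by rewrite formDl formNl. Qed.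

Lemma formDr x y z : form x (y + z) = form x y + form x z.
Proof. by rewrite formC formDl !(formC x). Qed.

Lemma formNr x z : form x (- z) = - form x z.
Proof. by rewrite formC formNl formC. Qed.

Lemma formBr x y z : form x (y - z) = form x y - form x z.
Proof. by rewrite formDr formNr. Qed.

Lemma formZr k x z : form x (k *: z) = k * form x z.
Proof. by rewrite formC formZl formC. Qed.

Lemma form0l z : form 0 z = 0.
Proof. by rewrite -(scale0r 0) formZl mul0r. Qed.

Lemma form_suml (J : Type) (s : seq J) (A : pred J) (F : J -> 'rV[rat]_n) z :
  form (\sum_(j <- s | A j) F j) z = \sum_(j <- s | A j) form (F j) z.
Proof.
by apply: (big_morph (fun x => form x z) (fun x y => formDl x y z) (form0l z)).
Qed.

Lemma form_sumr (J : Type) (s : seq J) (A : pred J) (F : J -> 'rV[rat]_n) z :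
  form z (\sum_(j <- s | A j) F j) = \sum_(j <- s | A j) form z (F j).
Proof. by rewrite formC form_suml; apply: eq_bigr => j _; rewrite formC. Qed.

Lemma form_ge0 x : 0 <= form x x.
Proof. by apply: sumr_ge0 => c _; rewrite -expr2 sqr_ge0. Qed.

Lemma form_le0 x : form x x <= 0 -> x = 0.
Proof.
move=> h; have /eqP : form x x == 0 by rewrite eq_le h form_ge0.
move/psumr_eq0P => /= e; apply: coroots_separate => c.
have /eqP := e (fun c _ => sqr_ge0 (dot x (ct c))) c isT.
by rewrite mulf_eq0 orbb => /eqP.
Qed.

Lemma rt_neq0 a : rt a != 0.
Proof.
apply/eqP => e; have := dot_rt_ct a; rewrite e dot0l => /eqP.
by rewrite eq_sym pnatr_eq0.
Qed.

Lemma form_rt_gt0 a : 0 < form (rt a) (rt a).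
Proof.
by rewrite ltNge; apply/negP => /form_le0 /eqP; rewrite (negPf (rt_neq0 a)).
Qed.

(** The reflection [s] in [a] permutes the coroots by duality, so it preserves [form]. Expanding
    [form (s x) (s (rt a)) = form x (rt a)] with [s (rt a) = - rt a] gives the identity. *)
Lemma form_rtr x a : 2 * form x (rt a) = dot x (ct a) * form (rt a) (rt a).
Proof.
pose s y := y - dot y (ct a) *: rt a.
have [h hE] := fin_all_exists (ct_refl a).
have sE y c : dot (s y) (ct c) = dot y (ct (h c)).
  by rewrite /s dotBl dotZl hE dotBr dotZr [dot y _ * _]mulrC.
have h_inj : injective h.
  apply: (can_inj (g := h)) => c; apply: ct_inj.
  rewrite !hE dotBr dotZr dot_rt_ct; move: (dot _ _) => t.
  by apply/rowP => j; rewrite !mxE; ring.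
have inv y z : form (s y) (s z) = form y z.
  rewrite /form [RHS](reindex_inj h_inj).
  by apply: eq_bigr => c _; rewrite !sE.
have := inv x (rt a).
rewrite /s dot_rt_ct formBl !formBr !formZl !formZr.
move: (form x _) (form (rt a) (rt a)) (dot _ _) => u v t; lra.
Qed.

(** Both Cartan integers [p], [q] are positive. If one of them is 1, a reflection produces the
    difference up to sign; if both are at least 2, the squared norm of [rt a - rt b] is at most 0,
    forcing [a = b]. *)
Lemma root_sub a b : 0 < form (rt a) (rt b) -> a != b ->
  exists c, rt c = rt a - rt b.
Proof.
move=> h ab; have [p hp] := cartan_int a b; have [q hq] := cartan_int b a.
have eb := form_rtr (rt a) b; have ea := form_rtr (rt b) a.
rewrite hp in eb; rewrite hq formC in ea.
have ga := form_rt_gt0 a; have gb := form_rt_gt0 b.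
have p0 : 0 < p by rewrite -(ltr0z rat) -(pmulr_lgt0 _ gb) -eb mulr_gt0.
have q0 : 0 < q by rewrite -(ltr0z rat) -(pmulr_lgt0 _ ga) -ea mulr_gt0.
have [p1|p1] := eqVneq p 1.
  by exists (refl D b a); rewrite rt_refl hp p1 scale1r.
have [q1|q1] := eqVneq q 1.
  by exists (opp (refl D a b)); rewrite rt_opp rt_refl hq q1 scale1r opprB.
have p2 : (2 : rat) <= p%:~R by rewrite -[2]/(2%:~R) ler_int; lia.
have q2 : (2 : rat) <= q%:~R by rewrite -[2]/(2%:~R) ler_int; lia.
case/eqP: ab; apply: rt_inj; apply/eqP; rewrite -subr_eq0; apply/eqP.
apply: form_le0; rewrite formBl !formBr (formC (rt b) (rt a)).
move: ea eb ga gb h p2 q2.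
move: (form (rt a) (rt a)) (form (rt b) (rt b)) (form (rt a) (rt b)).
move: (p%:~R) (q%:~R).
move=> P Q A B C ea eb ga gb h p2 q2; nra.
Qed.

(** If [w] has nonnegative products with [u] and [v], then [form q p >= form p p > 0], where
    [p = u + v]. So [q] has a positive product with [u] or [v], and subtracting that one from [q]
    leaves a root. *)
Lemma root_add_assoc u v w p q : rt p = rt u + rt v -> rt q = rt p + rt w ->
  rt u + rt w != 0 -> rt v + rt w != 0 ->
  (exists c, rt c = rt u + rt w) \/ (exists c, rt c = rt v + rt w).
Proof.
move=> ep eq nu nv.
have sub a b : 0 < form (rt a) (rt b) -> rt a - rt b != 0 ->
    exists c, rt c = rt a - rt b.
  move=> h ab; apply: root_sub h _; apply: contraNneq ab => ->.
  by rewrite subrr.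
have add a b : form (rt a) (rt b) < 0 -> rt a + rt b != 0 ->
    exists c, rt c = rt a + rt b.
  move=> h ab; have := @sub a (opp b); rewrite rt_opp formNr opprK oppr_gt0.
  exact.
have [h|uw] := ltP (form (rt u) (rt w)) 0; first by left; apply: add.
have [h|vw] := ltP (form (rt v) (rt w)) 0; first by right; apply: add.
have [h|qu] := ltP 0 (form (rt q) (rt u)).
  have e : rt q - rt u = rt v + rt w.
    by rewrite eq ep [rt u + _]addrC addrAC addrK.
  by right; rewrite -e; apply: sub h _; rewrite e.
have [h|qv] := ltP 0 (form (rt q) (rt v)).
  have e : rt q - rt v = rt u + rt w by rewrite eq ep addrAC addrK.
  by left; rewrite -e; apply: sub h _; rewrite e.
have := form_rt_gt0 p; move: qu qv.
have e : form (rt p) (rt p) = form (rt p) (rt u) + form (rt p) (rt v).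
  by rewrite -formDr -ep.
rewrite e eq 2!formDl (formC (rt w)) (formC (rt w)); lra.
Qed.


(** [Q] is the positive system of the open chamber containing [l]. A rational [l] lets Weyl matrices
    and negation act directly on these witnesses. *)
Definition separates (l : 'rV[rat]_n) (Q : {set I}) : Prop :=
  forall a, if a \in Q then 0 < dot (rt a) l else dot (rt a) l < 0.

Lemma separates_pos l Q a : separates l Q -> (0 < dot (rt a) l) = (a \in Q).
Proof. by move/(_ a); case: (a \in Q) => // h; rewrite lt_gtF. Qed.

Lemma separates_neg l Q a : separates l Q -> (dot (rt a) l < 0) = (a \notin Q).
Proof. by move/(_ a); case: (a \in Q) => // h; rewrite lt_gtF. Qed.

Lemma separates_opp l Q a : separates l Q -> (opp a \in Q) = (a \notin Q).
Proof.
move=> h; rewrite -(separates_pos _ h) -(separates_neg _ h).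
by rewrite rt_opp dotNl oppr_gt0.
Qed.

Lemma positive_system_separates P : positive_system D P ->
  exists l, separates l P.
Proof.
move=> [l [l0 ->]]; exists (map_mx intr l) => a.
rewrite inE dot_map ltrz0 ltr0z; have := l0 a.
by case: (ltgtP 0 (pairing _ _)).
Qed.

Lemma separates_setC l Q : separates l Q -> separates (- l) (~: Q).
Proof.
move=> h a; have := h a; rewrite inE dotNr oppr_gt0 oppr_lt0.
by case: (a \in Q).
Qed.

Lemma separates_preim l Q w : w \in weyl D -> separates l Q ->
  exists l', separates l' (w @^-1: Q).
Proof.
move=> /weyl_linear [M [hM _]] h; exists (l *m M^T) => a.
by rewrite inE -dot_mulmxl -hM; apply: h.
Qed.

(** * Positive systems *)

Section PositiveSystem.
Variables (l : 'rV[rat]_n) (Q : {set I}).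
Hypothesis sepQ : separates l Q.
Implicit Types s t : seq I.

Local Notation simple := (simple_roots D Q).

Lemma simpleP a :
  reflect (a \in Q /\ forall b c, b \in Q -> c \in Q -> rt a <> rt b + rt c)
          (a \in simple).
Proof.
have E b c :
    (Defs.root D a == Defs.root D b + Defs.root D c) = (rt a == rt b + rt c).
  by rewrite -map_intr_add (inj_eq map_intr_inj).
rewrite inE; apply: (iffP andP) => -[aQ h]; split=> //.
  move=> b c bQ cQ /eqP e; case/negP: h.
  by apply/existsP; exists b; rewrite bQ; apply/existsP; exists c; rewrite cQ E.
apply/negP => /existsP [b /andP [bQ /existsP [c /andP [cQ]]]].
by rewrite E => /eqP; apply: h.
Qed.

Lemma simple_sub a : a \in simple -> a \in Q.
Proof. by case/simpleP. Qed.

(** Nonnegative integral combinations of roots are sequences with repetition, so that single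
    summands can be removed and the number of summands minimized. *)
Definition vsum s : 'rV[rat]_n := \sum_(q <- s) rt q.

Lemma vsum_cons q s : vsum (q :: s) = rt q + vsum s.
Proof. exact: big_cons. Qed.

Lemma vsum_perm s t : perm_eq s t -> vsum s = vsum t.
Proof. exact: perm_big. Qed.

Lemma vsum_rem q s : q \in s -> vsum s = rt q + vsum (rem q s).
Proof. by move=> qs; rewrite (vsum_perm (perm_to_rem qs)) vsum_cons. Qed.

Lemma vsum_filter (T : pred I) s :
  vsum s = vsum (filter T s) + vsum (filter (predC T) s).
Proof. by rewrite /vsum !big_filter [LHS](bigID T). Qed.

Lemma dot_vsum_ge0 s : {subset s <= Q} -> 0 <= dot (vsum s) l.
Proof.
move=> sQ; rewrite dot_suml big_seq; apply: sumr_ge0 => q /sQ qQ.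
by rewrite ltW // (separates_pos _ sepQ).
Qed.

Lemma dot_addv_gt0 a s : a \in Q -> {subset s <= Q} ->
  0 < dot (rt a + vsum s) l.
Proof.
by move=> aQ /dot_vsum_ge0 h; rewrite dotDl ltr_pwDl // (separates_pos _ sepQ).
Qed.

Lemma addv_neq0 a s : a \in Q -> {subset s <= Q} -> rt a + vsum s != 0.
Proof.
move=> aQ sQ; apply/eqP => e; have := dot_addv_gt0 aQ sQ.
by rewrite e dot0l ltxx.
Qed.

Lemma mem_addv (y : I) a s : rt y = rt a + vsum s -> a \in Q ->
  {subset s <= Q} -> y \in Q.
Proof. by move=> e aQ sQ; rewrite -(separates_pos _ sepQ) e dot_addv_gt0. Qed.

Lemma mem_add (y : I) a b : rt y = rt a + rt b -> a \in Q -> b \in Q -> y \in Q.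
Proof.
move=> e aQ bQ; apply: (mem_addv (a := a) (s := [:: b])) => //.
  by rewrite /vsum big_seq1.
by move=> q; rewrite inE => /eqP ->.
Qed.

(** Induction on the number of roots of [Q] with a smaller value under [l]: a root that is not
    simple splits into two roots of [Q], each of smaller value. *)
Lemma simple_decomp a : a \in Q ->
  exists s, {subset s <= simple} /\ rt a = vsum s.
Proof.
have [m] := ubnP #|[set b in Q | dot (rt b) l < dot (rt a) l]|.
elim: m a => // m IH a; rewrite ltnS => le_m aQ.
have [aS|] := boolP (a \in simple).
  exists [:: a]; split=> [q|]; first by rewrite inE => /eqP ->.
  by rewrite /vsum big_seq1.
rewrite inE aQ negbK => /existsP [b /andP [bQ /existsP [c /andP [cQ]]]].
move=> /eqP/(congr1 (map_mx intr : _ -> 'rV[rat]_n)).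
rewrite map_intr_add -!/(rt _) => e.
have lt_ab p q : rt a = rt p + rt q -> p \in Q -> q \in Q ->
    exists s, {subset s <= simple} /\ rt p = vsum s.
  move=> epq pQ qQ; have ltpa : dot (rt p) l < dot (rt a) l.
    by rewrite epq dotDl ltrDl (separates_pos _ sepQ).
  apply: IH => //; apply: leq_trans le_m; apply: proper_card.
  apply/properP; split.
    apply/subsetP => d; rewrite !inE => /andP [-> /= h]; exact: lt_trans ltpa.
  by exists p; rewrite !inE pQ // ltxx.
have [s [sS es]] := lt_ab b c e bQ cQ.
have [t [tS et]] := lt_ab c b (etrans e (addrC _ _)) cQ bQ.
exists (s ++ t); split; last by rewrite e es et /vsum big_cat.
by move=> q; rewrite mem_cat => /orP [/sS|/tS].
Qed.

Lemma vsum_count s : {subset s <= simple} ->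
  vsum s = \sum_(d in simple) (count_mem d s)%:R *: rt d.
Proof.
elim: s => [|q s IH] sS.
  by rewrite /vsum big_nil big1 // => d _; rewrite scale0r.
rewrite vsum_cons IH => [|d ds]; last by apply: sS; rewrite inE ds orbT.
have qS : q \in simple by apply: sS; rewrite mem_head.
rewrite (bigD1 q) // [RHS](bigD1 q) //= addrA eqxx natrD scalerDl scale1r.
congr (_ + _); apply: eq_bigr => d /andP [_ /negPf dq].
by rewrite [q == d]eq_sym dq.
Qed.

(** Otherwise [rt d - rt e] is a root; it or its opposite lies in [Q], and this decomposes [d] or
    [e]. *)
Lemma simple_form_le0 d e : d \in simple -> e \in simple -> d != e ->
  form (rt d) (rt e) <= 0.
Proof.
move=> /simpleP [dQ hd] /simpleP [eQ he] de; rewrite leNgt; apply/negP => h.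
have [c ec] := root_sub h de.
have [cQ|cQ] := boolP (c \in Q).
  by apply: (hd c e) => //; rewrite ec subrK.
rewrite -(separates_opp _ sepQ) in cQ.
by apply: (he (opp c) d) => //; rewrite rt_opp ec opprB subrK.
Qed.

(** Separate the coefficients into positive and negative parts, giving two expressions of one vector
    [v]. In [form v v] the diagonal terms vanish and the others are at most 0, so [v = 0]. *)
Lemma simple_indep (c : I -> rat) :
  \sum_(d in simple) c d *: rt d = 0 -> forall d, d \in simple -> c d = 0.
Proof.
move=> c0; pose p d := Num.max (c d) 0; pose m d := Num.max (- c d) 0.
have cE d : c d = p d - m d.
  rewrite /p /m; have [h|h] := leP (c d) 0.
    by rewrite max_l ?oppr_ge0 // sub0r opprK.
  by rewrite max_r ?oppr_le0 ?subr0 // ltW.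
have p0 d : 0 <= p d by rewrite le_max lexx orbT.
have m0 d : 0 <= m d by rewrite le_max lexx orbT.
have pm d : p d * m d = 0.
  rewrite /p /m; have [h|h] := leP (c d) 0; first by rewrite mul0r.
  by rewrite max_r ?mulr0 // oppr_le0 ltW.
pose v := \sum_(d in simple) p d *: rt d.
have vE : v = \sum_(d in simple) m d *: rt d.
  apply/eqP; rewrite -subr_eq0 /v -sumrB; apply/eqP; rewrite -[RHS]c0.
  apply: eq_bigr => d _.
  by rewrite -scalerBl -cE.
have v0 : v = 0.
  apply: form_le0; rewrite {2}vE form_suml; apply: sumr_le0 => d dS.
  rewrite form_sumr; apply: sumr_le0 => e eS; rewrite formZl formZr mulrA.
  have [<-|de] := eqVneq d e; first by rewrite pm mul0r.
  by apply: mulr_ge0_le0; [apply: mulr_ge0|apply: simple_form_le0].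
(* Apply [l], which is positive on every simple root. *)
have zero (k : I -> rat) : (forall d, 0 <= k d) ->
    \sum_(d in simple) k d *: rt d = 0 -> forall d, d \in simple -> k d = 0.
  move=> k0 /(congr1 (fun x => dot x l)); rewrite dot0l dot_suml => /eqP h d dS.
  have ld e : e \in simple -> 0 < dot (rt e) l.
    by move=> /simple_sub eQ; rewrite (separates_pos _ sepQ).
  move: h; rewrite psumr_eq0 => [/allP/(_ d)|e eS].
    rewrite mem_index_enum dS dotZl mulf_eq0 => /(_ isT) /orP [/eqP -> //|].
    by rewrite gt_eqF // ld.
  by rewrite dotZl mulr_ge0 // ltW // ld.
move=> d dS; rewrite cE (zero p) // ?(zero m) ?subrr // -vE //.
Qed.

(** For a negative root [b], a nonzero coordinate at [d] means that [d] occurs in the decomposition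
    of [- rt b]; the third clause takes one copy of it out, in the form used by [wall_height_lt]. *)
Lemma simple_coord : exists e : I -> I -> rat,
  [/\ forall b, rt b = \sum_(d in simple) e b d *: rt d,
      forall b d, b \in simple -> d \in simple -> e b d = (b == d)%:R &
      forall b d, b \notin Q -> d \in simple -> e b d != 0 ->
        exists s, {subset s <= Q} /\ - rt b = rt d + vsum s].
Proof.
have one b : exists f : I -> rat,
    (rt b = \sum_(d in simple) f d *: rt d) /\
    (b \notin Q -> forall d, d \in simple -> f d != 0 ->
        exists s, {subset s <= Q} /\ - rt b = rt d + vsum s).
  have [bQ|bQ] := boolP (b \in Q).
    have [s [sS es]] := simple_decomp bQ.
    by exists (fun d => (count_mem d s)%:R); split=> //; rewrite es vsum_count.
  have bQ' : opp b \in Q by rewrite (separates_opp _ sepQ).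
  have [s [sS]] := simple_decomp bQ'; rewrite rt_opp => es.
  exists (fun d => - (count_mem d s)%:R); split.
    rewrite -[LHS]opprK es vsum_count // -sumrN.
    by apply: eq_bigr => d _; rewrite scaleNr.
  move=> _ d dS; rewrite oppr_eq0 pnatr_eq0 -lt0n -has_count has_pred1 => ds.
  exists (rem d s); split; last by rewrite es -vsum_rem.
  by move=> q /mem_rem /sS /simple_sub.
have [e he] := fin_all_exists one; exists e; split=> [b|b d bS dS|b d].
- by case: (he b).
- have [eb _] := he b; apply/eqP; rewrite -subr_eq0; apply/eqP.
  apply: (simple_indep (c := fun d => e b d - (b == d)%:R)) dS.
  under eq_bigr => q _ do rewrite scalerBl.
  rewrite sumrB -eb (bigD1 b) //= eqxx scale1r big1 ?addr0 ?subrr // => q.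
  by case/andP => _; rewrite eq_sym => /negPf ->; rewrite scale0r.
- by have [_ h] := he b => bQ; apply: h.
Qed.

(** * Sums of positive roots with as few summands as possible *)

Lemma vsum_filter_rem (T : pred I) p s : p \in s -> ~~ T p ->
  vsum (filter T (rem p s)) = vsum (filter T s).
Proof.
move=> ps /negPf Tp; have := perm_filter T (perm_to_rem ps).
by rewrite /= Tp => /vsum_perm ->.
Qed.

Lemma dot_vsum_le0 s : {subset s <= ~: Q} -> dot (vsum s) l <= 0.
Proof.
move=> sQ; rewrite dot_suml big_seq; apply: sumr_le0 => q /sQ.
by rewrite inE => qQ; rewrite ltW // (separates_neg _ sepQ).
Qed.

Lemma size_rem_lt p s : p \in s -> (size (rem p s) < size s)%N.
Proof. by move=> ps; rewrite size_rem //; case: s ps. Qed.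

Definition minsum s : Prop :=
  {subset s <= Q} /\
  forall t, {subset t <= Q} -> vsum t = vsum s -> (size s <= size t)%N.

Lemma minsum_exists s : {subset s <= Q} ->
  exists t, vsum t = vsum s /\ minsum t.
Proof.
move=> sQ.
(* Tuples over a finite type make this a boolean predicate, so a least length can be chosen. *)
pose short m := [exists t : m.-tuple I, all (mem Q) t && (vsum t == vsum s)].
have shortE t : {subset t <= Q} -> vsum t = vsum s -> short (size t).
  move=> tQ et; apply/existsP; exists (in_tuple t); rewrite et eqxx andbT.
  by apply/allP.
have exm : exists m, short m by exists (size s); apply: shortE.
case: (ex_minnP exm) => m /existsP [t /andP [/allP tQ /eqP et]] min_m.
exists t; split=> //; split=> // u uQ eu.
by rewrite size_tuple; apply: min_m; apply: shortE; rewrite ?eu.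
Qed.

Lemma minsum_rem p s : p \in s -> minsum s -> minsum (rem p s).
Proof.
move=> ps [sQ ms]; split=> [q /mem_rem /sQ //|t tQ et].
rewrite size_rem // -subn1 leq_subLR add1n -/(size (p :: t)).
apply: ms; last by rewrite vsum_cons et -vsum_rem.
by move=> q; rewrite inE => /orP [/eqP ->|/tQ //]; apply: sQ.
Qed.

(** Replacing [p] and [q] by the single root [c] would shorten the sum. *)
Lemma minsum_not_root p q s c : minsum s -> p \in s -> q \in rem p s ->
  rt c <> rt p + rt q.
Proof.
move=> [sQ ms] ps qs ec.
have cQ : c \in Q by apply: mem_add ec _ _; apply: sQ; rewrite ?(mem_rem qs).
have := ms (c :: rem q (rem p s)); rewrite /= !size_rem //.
have : (1 < size s)%N.
  have := size_rem qs; have := size_rem ps; case: (size s) => [|[|m]] //.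
    by case: (rem p s) qs.
  by move=> /size0nil e; rewrite e in qs.
case: (size s) => [|[|m]] //= _ h; suff : (m.+2 <= m.+1)%N by rewrite ltnn.
apply: h; last by rewrite vsum_cons ec -addrA -vsum_rem // -vsum_rem.
move=> d; rewrite inE => /orP [/eqP -> //|]; by move=> /mem_rem /mem_rem /sQ.
Qed.

(** As [form (rt x) (rt x) > 0], [x] has a positive product with [a] or with a summand. In the first
    case [x - a] would be one root equal to the whole sum, against minimality; in the second that
    summand can be subtracted. *)
Lemma minsum_peel_one s a (x : I) : a \in Q -> minsum s -> s != [::] ->
  rt x = rt a + vsum s ->
  exists2 q, q \in s & exists y : I, rt y = rt a + vsum (rem q s).
Proof.
move=> aQ [sQ ms] s0 ex; have [s1|s1] := leqP (size s) 1.
  case: s s0 s1 {sQ ms ex} => [|q [|//]] // _ _.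
  exists q; first exact: mem_head.
  by exists a; rewrite /= eqxx /vsum big_nil addr0.
have [h|xa] := ltP 0 (form (rt x) (rt a)).
  have [|c] := root_sub h.
    apply: contraTneq isT => xa; move: ex; rewrite xa -[LHS]addr0 => /addrI e.
    case: s s0 sQ e {ms s1} => [|q s] // _ sQ /eqP.
    rewrite eq_sym vsum_cons (negPf (addv_neq0 _ _)) //.
      exact/sQ/mem_head.
    by move=> d ds; apply: sQ; rewrite inE ds orbT.
  rewrite ex [rt a + _]addrC addrK => ec.
  have cQ : c \in Q.
    have /hasP [q qs _] : has predT s by rewrite has_predT lt0n size_eq0.
    apply: (mem_addv (a := q) (s := rem q s)); rewrite -?vsum_rem //.
      exact: sQ.
    by move=> d /mem_rem /sQ.
  have := ms [:: c]; rewrite leqNgt s1 => h'; suff : false by [].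
  apply: h'; last by rewrite /vsum big_seq1.
  by move=> d; rewrite inE => /eqP ->.
have [/hasP [q qs h]|] := boolP (has (fun q => 0 < form (rt x) (rt q)) s).
  exists q => //; have [|c] := root_sub h.
    apply: contraTneq isT => xq; move: ex; rewrite xq (vsum_rem qs) addrCA.
    rewrite -[LHS]addr0 => /addrI /eqP.
    rewrite eq_sym (negPf (addv_neq0 _ _)) //.
    by move=> d /mem_rem /sQ.
  by rewrite ex (vsum_rem qs) addrCA [rt q + _]addrC addrK => ec; exists c.
rewrite -all_predC => /allP hs; have := form_rt_gt0 x.
rewrite {2}ex formDr ltNge => /negP [].
rewrite -[leRHS]addr0; apply: lerD => //.
rewrite form_sumr big_seq; apply: sumr_le0 => q /hs /=.
by rewrite -leNgt.
Qed.

(* Two summands of a minimal s never add up to a root, so of the alternatives of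
   root_add_assoc only the one allowing to exchange them survives. *)
Lemma minsum_peel s a (x : I) : a \in Q -> minsum s -> rt x = rt a + vsum s ->
  forall p, p \in s -> exists y : I, rt y = rt a + vsum (rem p s).
Proof.
move=> aQ; have [m] := ubnP (size s); elim: m s x => // m IH s x.
rewrite ltnS => le_m ms ex p ps; have [sQ _] := ms.
have s0 : s != [::] by case: s ps {le_m ms ex sQ}.
have [q qs [y ey]] := minsum_peel_one aQ ms s0 ex.
have [<-|qp] := eqVneq q p; first by exists y.
have prem : p \in rem q s.
  have := perm_mem (perm_to_rem qs) p.
  by rewrite ps inE eq_sym (negPf qp) /= => <-.
have qrem : q \in rem p s.
  have := perm_mem (perm_to_rem ps) q.
  by rewrite qs inE (negPf qp) /= => <-.
have [|z ez] := IH (rem q s) y _ (minsum_rem qs ms) ey p prem.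
  exact: leq_trans (size_rem_lt qs) le_m.
(* Now [x = (z + p) + q], and the root sought is [z + q]. *)
have eyz : rt y = rt z + rt p by rewrite ey ez (vsum_rem prem) addrCA addrC.
have exy : rt x = rt y + rt q by rewrite ex ey (vsum_rem qs) addrCA addrC.
have ezq : rt z + rt q = rt a + vsum (rem p s).
  apply: (addIr (rt p)); rewrite addrAC -eyz -exy ex (vsum_rem ps).
  by rewrite [in LHS]addrCA addrC.
have remQ r : {subset rem r s <= Q} by move=> d /mem_rem /sQ.
case: (root_add_assoc eyz exy).
- by rewrite ezq addv_neq0.
- rewrite -(big_seq1 +%R q rt) addv_neq0 //; first exact: sQ.
  by move=> d; rewrite inE => /eqP ->; apply: sQ.
- by move=> [c ec]; exists c; rewrite ec.
- by move=> [c /(minsum_not_root ms ps qrem)].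
Qed.

Lemma minsum_filter (T : pred I) s a (x : I) : a \in Q -> minsum s ->
  rt x = rt a + vsum s -> exists y : I, rt y = rt a + vsum (filter T s).
Proof.
move=> aQ; have [m] := ubnP (size s); elim: m s x => // m IH s x.
rewrite ltnS => le_m ms ex; have [/all_filterP ->|] := boolP (all T s).
  by exists x.
rewrite -has_predC => /hasP [p ps /= Tp].
have [y ey] := minsum_peel aQ ms ex ps.
rewrite -(vsum_filter_rem ps Tp); apply: IH (minsum_rem ps ms) ey.
exact: leq_trans (size_rem_lt ps) le_m.
Qed.

End PositiveSystem.

(* Here -b has the wall a of Pi in its support with respect to Pi.  Write
   -b = a + sum s with s minimal: as b is indecomposable in Pj, removing any
   element of s leaves one root in Pj and one in Pk.  Splitting s along Pj gives
   roots yJ, yK outside P0 with yJ + yK = a - b. *)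
Lemma wall_height_lt l0 li lj lk (P0 Pi Pj Pk : {set I}) a b s :
  separates l0 P0 -> separates li Pi -> separates lj Pj -> separates lk Pk ->
  (forall c, (c \in P0) + (c \in Pi) + (c \in Pj) + (c \in Pk) = 2)%N ->
  b \in simple_roots D Pj -> b \in P0 -> a \in Pi -> a \in P0 ->
  {subset s <= Pi} -> - rt b = rt a + vsum s ->
  dot (rt a) l0 < dot (rt b) l0.
Proof.
move=> h0 hi hj hk two bS b0 ai a0 sPi ebs.
have [bj b_indec] := simpleP _ _ bS.
have [t [et ms]] := minsum_exists sPi; rewrite -{}et in ebs.
move: {s sPi}t ebs ms => s ebs ms; have [sPi _] := ms.
pose x := opp b; have ex : rt x = rt a + vsum s by rewrite rt_opp.
(* Besides [Pi], each of [y], [z] lies in exactly one of [P0], [Pj], [Pk]. Exactly one is in [Pj],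
   since [b] is indecomposable there and [x] is negative; as [x] is in [Pk], the other must be in
   [Pk]. *)
have splitx (y z : I) : rt x = rt y + rt z -> y \in Pi -> z \in Pi ->
    (y \in Pj) && (z \in Pk) && (z \notin Pj)
    || (y \in Pk) && (z \in Pj) && (y \notin Pj).
  move=> exyz yi zi.
  have nj : (y \in Pj) || (z \in Pj).
    rewrite -[_ || _]negbK negb_or -!(separates_opp _ hj); apply/negP.
    case/andP => yj zj; apply: (b_indec _ _ yj zj).
    by rewrite !rt_opp -opprD -exyz rt_opp opprK.
  have x0 : x \notin P0 by rewrite (separates_opp _ h0) b0.
  have xj : x \notin Pj by rewrite (separates_opp _ hj) bj.
  have xi : x \in Pi by exact: (mem_add hi exyz yi zi).
  have n0 : ~~ ((y \in P0) && (z \in P0)).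
    by apply: contra x0 => /andP [y0 z0]; exact: (mem_add h0 exyz y0 z0).
  have nj2 : ~~ ((y \in Pj) && (z \in Pj)).
    by apply: contra xj => /andP [y0 z0]; exact: (mem_add hj exyz y0 z0).
  have k2 : (y \in Pk) || (z \in Pk).
    rewrite -[_ || _]negbK negb_or -!(separates_opp _ hk); apply/negP.
    case/andP => yk zk; have : opp x \in Pk.
      by apply: (mem_add hk _ yk zk); rewrite rt_opp exyz opprD !rt_opp.
    rewrite (separates_opp _ hk); have := two x.
    by rewrite xi (negPf x0) (negPf xj); case: (x \in Pk).
  have := two y; have := two z; move: nj n0 nj2 k2; rewrite yi zi.
  by do 3!case: (y \in _); do 3!case: (z \in _).
have remPi p : {subset rem p s <= Pi} by move=> d /mem_rem /sPi.
have peel p : p \in s -> exists y : I, [/\ rt y = rt a + vsum (rem p s) &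
    (y \in Pj) && (p \in Pk) && (p \notin Pj)
    || (y \in Pk) && (p \in Pj) && (y \notin Pj)].
  move=> ps; have [y ey] := minsum_peel hi ai ms ex ps; exists y; split=> //.
  apply: splitx; last exact: sPi.
    by rewrite ey ex (vsum_rem ps) addrCA addrC.
  exact: (mem_addv hi ey ai (remPi p)).
pose J := [pred d | d \in Pj].
have [yJ eJ] := minsum_filter hi J ai ms ex.
have [yK eK] := minsum_filter hi (predC J) ai ms ex.
have filt T : {subset filter T s <= Pi}.
  by move=> d; rewrite mem_filter => /andP [_ /sPi].
have yJi : yJ \in Pi by exact: (mem_addv hi eJ ai (filt _)).
have yKi : yK \in Pi by exact: (mem_addv hi eK ai (filt _)).
have [ak aj] : a \notin Pk /\ a \notin Pj.
  by have := two a; rewrite a0 ai; case: (a \in Pj); case: (a \in Pk).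
have xk : x \in Pk.
  have := two x; rewrite (separates_opp _ h0) (separates_opp _ hj) b0 bj.
  by case: (x \in Pk); case: (x \in Pi).
(* If all of [s] were in [Pj], then [a] and all of [s] would be outside [Pk], contradicting [xk]. *)
have pK : has (predC J) s.
  rewrite has_predC; apply/negP => /allP sJ; have := separates_pos x hk.
  rewrite xk ex dotDl => /idP; apply/negP; rewrite -leNgt.
  rewrite -[leRHS]addr0; apply: lerD.
    by rewrite ltW // (separates_neg _ hk).
  apply: (dot_vsum_le0 hk) => d ds; rewrite inE.
  have := two d; rewrite (sPi d ds); have /= -> := sJ d ds.
  by case: (d \in P0); case: (d \in Pk).
(* Peeling off one [p] outside [Pj] leaves a root of [Pj]; dropping the other summands outside [Pj]
   can only increase [lj]. *)
have yJj : yJ \in Pj.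
  have /hasP [p ps /= pJ] := pK; have [y [ey]] := peel p ps.
  rewrite (negPf pJ) !andbF orbF andbT => /andP [yj _].
  rewrite -(separates_pos _ hj) in yj; rewrite -(separates_pos _ hj).
  apply: lt_le_trans yj _; rewrite ey eJ (vsum_filter J (rem p s)).
  rewrite vsum_filter_rem //.
  rewrite addrA [leLHS]dotDl gerDl; apply: (dot_vsum_le0 hj) => d.
  by rewrite mem_filter in_setC => /andP [/= ->].
have pJ : has J s.
  apply: contraTT yJj; rewrite -all_predC => /allP sJ.
  rewrite -(separates_neg _ hj) eJ (eq_in_filter (a2 := pred0)).
    by rewrite filter_pred0 /vsum big_nil addr0 (separates_neg _ hj).
  by move=> d /sJ /= /negPf.
(* The same argument for [lk]: summands in [Pj] are already in [Pi], hence outside [Pk]. *)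
have yKk : yK \in Pk.
  have /hasP [p ps /= pJ'] := pJ; have [y [ey]] := peel p ps.
  have pk : p \notin Pk.
    have := two p; rewrite (sPi _ ps) pJ'.
    by case: (p \in P0); case: (p \in Pk).
  rewrite (negPf pk) andbF /= => /andP [/andP [yk _] _].
  rewrite -(separates_pos _ hk) in yk; rewrite -(separates_pos _ hk).
  apply: lt_le_trans yk _; rewrite ey eK (vsum_filter (predC J) (rem p s)).
  rewrite vsum_filter_rem //=; last by rewrite negbK.
  rewrite addrA [leLHS]dotDl gerDl; apply: (dot_vsum_le0 hk) => d.
  rewrite mem_filter in_setC /= negbK => /andP [dj /mem_rem /sPi di].
  by have := two d; rewrite di dj; case: (d \in P0); case: (d \in Pk).
have yJ0 : yJ \notin P0.
  by have := two yJ; rewrite yJi yJj; case: (yJ \in P0); case: (yJ \in Pk).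
have yK0 : yK \notin P0.
  by have := two yK; rewrite yKi yKk; case: (yK \in P0); case: (yK \in Pj).
rewrite -(separates_neg _ h0) in yJ0; rewrite -(separates_neg _ h0) in yK0.
have e : rt b - rt a = - (rt yJ + rt yK).
  rewrite eJ eK addrACA -vsum_filter -addrA -ebs.
  by rewrite opprD opprK addrC.
rewrite -subr_gt0 -dotBl e dotNl dotDl oppr_gt0.
lra.
Qed.

(** * Cardinality bounds from ranks of matrices of roots *)

Lemma indep_card (U : {set I}) :
  (forall c : I -> rat, \sum_(b in U) c b *: rt b = 0 ->
     forall b, b \in U -> c b = 0) ->
  (#|U| <= n)%N.
Proof.
move=> indep; pose A := \matrix_(k < #|U|) rt (enum_val k).
suff /eqP <- : row_free A by apply: rank_leq_col.
rewrite -kermx_eq0; apply/eqP/row_matrixP => i; rewrite row0.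
set u := row i _; have uA : u *m A = 0 by apply/sub_kermxP; apply: row_sub.
(* Summing over the fibre of [enum_val] extends the row [u] by zero to a function on all of [I]. *)
pose c b := \sum_(k < #|U| | enum_val k == b) u 0 k.
have cE k : c (enum_val k) = u 0 k.
  by rewrite /c (big_pred1 k) // => j; rewrite (inj_eq enum_val_inj).
apply/rowP => k; rewrite -cE [RHS]mxE; apply: indep (enum_valP k).
rewrite big_enum_val -[RHS]uA mulmx_sum_row; apply: eq_bigr => j _.
by rewrite cE rowK.
Qed.

Lemma span_card (U : {set I}) :
  (forall b, exists c : I -> rat, rt b = \sum_(d in U) c d *: rt d) ->
  (n <= #|U|)%N.
Proof.
move=> span; pose A := \matrix_(k < #|U|) rt (enum_val k).
suff /eqP <- : row_full A by apply: rank_leq_row.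
rewrite -sub1mx; apply/row_subP => i; set x := row i _.
have [e ->] := rt_span x; apply: summx_sub => b _; apply: scalemx_sub.
have [c ->] := span b; apply: summx_sub => d dU; apply: scalemx_sub.
have -> : rt d = row (enum_rank_in dU d) A by rewrite rowK enum_rankK_in.
exact: row_sub.
Qed.

Lemma card_simple l Q : separates l Q -> #|simple_roots D Q| = n.
Proof.
move=> h; apply/eqP; rewrite eqn_leq; apply/andP; split.
  by apply: indep_card; apply: simple_indep h.
by apply: span_card => b; have [e [he _ _]] := simple_coord h; exists (e b).
Qed.

(** [k] is the remaining index; the conclusion is a sum so that the count over four chambers takes
    the shape required by [wall_height_lt]. *)
Lemma ord4_split (o i j : 'I_4) : o != i -> o != j -> i != j ->
  exists k : 'I_4, forall g : 'I_4 -> nat,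
    (\sum_m g m = g o + g i + g j + g k)%N.
Proof.
move=> oi oj ij; pose A : {set 'I_4} := ~: [set o; i; j].
have /cards1P [k Ak] : #|A| == 1%N.
  have := cardsC [set o; i; j].
  rewrite card_ord setUC cardsU1 cards2 !inE oi negb_or.
  rewrite [j == o]eq_sym oj [j == i]eq_sym ij setUC -/A /=.
  (* The complement of three points among four: 3 + #|A| = 3 + 1. *)
  by move=> /(@addnI 3 _ 1) ->.
exists k => g; rewrite (bigD1 o) // (bigD1 i) 1?eq_sym //=.
rewrite (bigD1 j) /=; last by rewrite ![j == _]eq_sym oj ij.
rewrite (big_pred1 k) ?addnA // => m.
have := in_set1 m k; rewrite -Ak !inE => <-.
by rewrite !negb_or.
Qed.

(** * Four chambers, any root being positive for exactly two of them *)

Section FourChambers.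
Variable F : 'I_4 -> {set I}.
Hypothesis sepF : forall i, exists l, separates l (F i).
Hypothesis twoF : forall a, (\sum_i (a \in F i) = 2)%N.

Local Notation walls i o := (simple_roots D (F i) :&: F o).

Lemma two_chambers a o i j : o != i -> a \in F o -> a \in F i -> a \in F j ->
  (j == o) || (j == i).
Proof.
move=> oi ao ai aj; rewrite -[_ || _]negbK negb_or; apply/negP => /andP [jo ji].
have := twoF a; rewrite (bigD1 o) // (bigD1 i) 1?eq_sym //= (bigD1 j) ?jo //=.
by rewrite ao ai aj.
Qed.

(* The functional of F o triangularizes the family: look at the coordinate of a
   vanishing combination on the highest root a that occurs in it. *)
Lemma walls_indep o :
  let U := \bigcup_(i | i != o) walls i o in
  forall c : I -> rat, \sum_(b in U) c b *: rt b = 0 ->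
  forall b, b \in U -> c b = 0.
Proof.
move=> U c c0 b1 b1U; apply/eqP; apply: contraT => cb1.
have [lo ho] := sepF o.
pose a := [arg max_(b > b1 | (b \in U) && (c b != 0)) dot (rt b) lo]%O.
have [aU ca amax] : [/\ a \in U, c a != 0 &
    forall b, b \in U -> c b != 0 -> dot (rt b) lo <= dot (rt a) lo].
  rewrite /a; case: arg_maxP => [|b /andP [bU cb] hb]; first by rewrite b1U.
  by split=> // d dU cd; apply: hb; rewrite dU.
have /bigcupP [i io] := aU; rewrite inE => /andP [aS ao].
have [li hi] := sepF i; have [e [he1 he2 he3]] := simple_coord hi.
have ai := simple_sub aS.
have : \sum_(b in U) c b * e b a = 0.
  apply: (simple_indep hi (c := fun d => \sum_(b in U) c b * e b d)) aS.
  under eq_bigr => d _ do rewrite scaler_suml.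
  rewrite exchange_big -[RHS]c0; apply: eq_bigr => b _.
  rewrite [in RHS]he1 scaler_sumr; apply: eq_bigr => d _.
  by rewrite scalerA.
rewrite (bigD1 a) //= he2 // eqxx mulr1 big1 ?addr0 => [/eqP|b /andP [bU ba]].
  by rewrite (negPf ca).
(* Every other term is 0. A wall of the same chamber has coordinate 0 at [a]; a wall of another
   chamber with nonzero coordinate would be strictly higher than [a], against maximality. *)
have [->|cb] := eqVneq (c b) 0; first by rewrite mul0r.
have /bigcupP [j jo] := bU; rewrite inE => /andP [bS bo].
have bj := simple_sub bS.
have [eij|ij] := eqVneq i j.
  by rewrite he2 ?(negPf ba) ?mulr0 // eij.
have bi : b \notin F i.
  apply/negP => bi; have := two_chambers jo bj bo bi.
  by rewrite (negPf ij) (negPf io).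
apply/eqP; rewrite mulf_eq0 (negPf cb) /=; apply: contraT => eba.
have [s [sPi es]] := he3 b a bi aS eba.
rewrite eq_sym in io; rewrite eq_sym in jo.
have [lj hj] := sepF j; have [k hk] := ord4_split io jo ij.
have [lk hlk] := sepF k.
have := wall_height_lt ho hi hj hlk _ bS bo ai ao sPi es.
rewrite ltNge amax // => h; suff : false by []; apply: h => d.
by rewrite -(hk (fun m => nat_of_bool (d \in F m))) twoF.
Qed.

Lemma card_mem_sum (A : {set I}) : #|A| = (\sum_a (a \in A))%N.
Proof. by rewrite -sum1_card big_mkcond; apply: eq_bigr => a _; case: ifP. Qed.

(** A root in [F o] lies in only one other chamber, so the sets counted are disjoint and the sum is
    the cardinality of their independent union. *)
Lemma card_walls_column o : (\sum_(i | i != o) #|walls i o| <= n)%N.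
Proof.
apply: leq_trans (indep_card (walls_indep (o := o))).
under eq_bigr => i _ do rewrite card_mem_sum.
set U := \bigcup_(i | _) _.
rewrite card_mem_sum exchange_big; apply: leq_sum => a _.
have [aU|aU] := boolP (a \in U); last first.
  rewrite big1 // => i io; apply/eqP; rewrite eqb0; apply: contra aU => aw.
  by apply/bigcupP; exists i.
have /bigcupP [i io] := aU; rewrite inE => /andP [aS ao].
rewrite (bigD1 i) //= inE aS ao big1 // => j /andP [jo ji]; apply/eqP.
rewrite eqb0 inE ao andbT; apply/negP => /simple_sub aj.
rewrite eq_sym in io; have := two_chambers io ao (simple_sub aS) aj.
by rewrite (negPf jo) (negPf ji).
Qed.

(** Each simple root of [F i] is positive on exactly one other chamber. *)
Lemma card_walls_row i : (\sum_(o | o != i) #|walls i o| = n)%N.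
Proof.
have [l h] := sepF i; rewrite -[RHS](card_simple h) card_mem_sum.
under eq_bigr => o _ do rewrite card_mem_sum.
rewrite exchange_big; apply: eq_bigr => a _.
under eq_bigr => o _ do rewrite inE.
have [aS|aS] := boolP (a \in simple_roots _ _); last by rewrite big1.
by have := twoF a; rewrite (bigD1 i) //= (simple_sub aS) => -[].
Qed.

Lemma card_walls o : (\sum_(i | i != o) #|walls i o| = n)%N.
Proof.
(* The column bounds make the truncated differences genuine; they sum to 0 because rows and columns
   have the same total. *)
have : (\sum_o (n - \sum_(i | i != o) #|walls i o|) = 0)%N.
  rewrite sumnB => [|j _]; last exact: card_walls_column.
  rewrite (exchange_big_dep predT) //=.
  rewrite [X in (_ - X)%N](eq_bigr (fun=> n)) ?subnn // => i _.
  by rewrite -[RHS](card_walls_row i); apply: eq_bigl => j; rewrite eq_sym.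
move/eqP; rewrite sum_nat_eq0 => /forallP /(_ o) /=; rewrite subn_eq0 => h.
by apply/eqP; rewrite eqn_leq card_walls_column.
Qed.

End FourChambers.

(** * Simple roots under the Weyl group and under negation *)

Lemma weyl_add w a b c : w \in weyl D ->
  rt a = rt b + rt c <-> rt (w a) = rt (w b) + rt (w c).
Proof.
move=> ww; split=> e.
  by have [M [hM _]] := weyl_linear ww; rewrite !hM e mulmxDl.
have [M [hM _]] := weyl_linear (groupVr ww).
by rewrite -(permK w a) -(permK w b) -(permK w c) !hM e mulmxDl.
Qed.

Lemma simple_preim w (Q : {set I}) : w \in weyl D ->
  simple_roots D (w @^-1: Q) = w @^-1: simple_roots D Q.
Proof.
move=> ww; apply/setP => a; rewrite [RHS]inE.
apply/simpleP/simpleP; rewrite inE => -[aQ h]; split=> // b c.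
  move=> bQ cQ; rewrite -(permKV w b) -(permKV w c) => /(weyl_add a _ _ ww).2.
  by apply: h; rewrite inE permKV.
by rewrite !inE => bQ cQ /(weyl_add a _ _ ww).1; apply: h.
Qed.

Lemma simple_setC l (Q : {set I}) : separates l Q ->
  simple_roots D (~: Q) = opp @^-1: simple_roots D Q.
Proof.
move=> h; have oppE a b c : rt a = rt b + rt c ->
    rt (opp a) = rt (opp b) + rt (opp c) by rewrite !rt_opp -opprD => ->.
apply/setP => a; rewrite [RHS]inE; apply/simpleP/simpleP.
  rewrite inE (separates_opp _ h) => -[aQ ha]; split=> // b c bQ cQ /oppE.
  by rewrite oppK; apply: ha; rewrite inE -(separates_opp _ h) oppK.
rewrite inE (separates_opp _ h) => -[aQ ha]; split=> // b c.
by rewrite !inE -!(separates_opp _ h) => bQ cQ /oppE; apply: ha.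
Qed.

Lemma reflK a : involutive (refl D a).
Proof.
move=> b; apply: rt_inj; rewrite !rt_refl dotBl dotZl dot_rt_ct.
by move: (dot _ _) => p; apply/rowP => j; rewrite !mxE; ring.
Qed.

(** * Descents as walls *)

Section Descents.
Variables (l : 'rV[rat]_n) (P : {set I}).
Hypothesis sepP : separates l P.

Local Notation simple := (simple_roots D P).

(** If [s_a b] were negative, [b + opp (s_a b)] would be a sum of positive roots that is a multiple
    of [a]. By independence only [a] occurs in the decomposition of [b], and reducedness gives
    [b = a] or [b = opp a]. *)
Lemma refl_simple a b : a \in simple -> b \in P -> b != a -> refl D a b \in P.
Proof.
move=> aS bP ba; apply: contraT; rewrite -(separates_opp _ sepP) => cP.
have [s [sS es]] := simple_decomp sepP bP.
have [t [tS et]] := simple_decomp sepP cP.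
pose p := dot (rt b) (ct a).
have e : vsum (s ++ t) = p *: rt a.
  rewrite /vsum big_cat /= -/(vsum s) -/(vsum t) -es -et.
  by rewrite rt_opp rt_refl opprB addrCA subrr addr0.
have cnt d : d \in simple -> (count_mem d (s ++ t))%:R - (d == a)%:R * p = 0.
  move: d; apply: (simple_indep sepP).
  under eq_bigr => d _ do rewrite scalerBl.
  rewrite sumrB -vsum_count => [|d]; last by rewrite mem_cat => /orP [/sS|/tS].
  rewrite e (bigD1 a) //= eqxx mul1r big1 ?addr0 ?subrr // => d.
  by case/andP => _ /negPf ->; rewrite mul0r scale0r.
have s_a d : d \in s -> d = a.
  move=> ds; apply/eqP; apply: contraT => /negPf da; have := cnt d (sS d ds).
  rewrite da mul0r subr0 => /eqP; rewrite pnatr_eq0 count_cat addn_eq0.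
  by case/andP; rewrite eqn0Ngt -has_count has_pred1 ds.
have eb : Defs.root D b = (size s)%:Z *: Defs.root D a.
  apply: map_intr_inj; rewrite map_intr_scale -/(rt b) -/(rt a) es /vsum.
  rewrite (eq_big_seq (fun=> rt a)) => [|d /s_a -> //].
  by rewrite big_const_seq count_predT iter_addr_0 scaler_nat.
have := @root_reduced _ _ D a b (size s) 1; rewrite scale1r eb.
case=> // [e1|e1]; rewrite -eb in e1.
  by rewrite (root_inj e1) eqxx in ba.
have boa : b = opp a.
  by apply: rt_inj; rewrite rt_opp /rt e1 map_intr_opp.
by rewrite boa (separates_opp _ sepP) (simple_sub aS) in bP.
Qed.

Lemma inv_setE w b : (b \in inv_set D P w) = (b \in P) && (w b \notin P).
Proof.
rewrite !inE; congr (_ && _); rewrite -(separates_opp _ sepP).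
apply/existsP/idP => [[c /andP [cP /eqP e]]|wb].
  suff -> : opp (w b) = c by [].
  by apply: rt_inj; rewrite rt_opp /rt e map_intr_opp opprK.
exists (opp (w b)); rewrite wb; apply/eqP; apply: map_intr_inj.
by rewrite map_intr_opp -/(rt _) -/(rt (opp _)) rt_opp opprK.
Qed.

(** By [refl_simple], composing [u] with [s_a] changes the inversion set only at [u^-1 a] or its
    opposite, whichever is positive. The two sets are therefore nested. *)
Lemma len_refl_simple u a : u \in weyl D -> a \in simple ->
  (len D P (wmul (refl D a) u) < len D P u)%N = ((u^-1)%g a \notin P).
Proof.
move=> uW aS; have aP := simple_sub aS; set g := (u^-1)%g a.
have ug : u g = a by rewrite permKV.
have [gP|gP] := boolP (g \in P).
  apply/negbTE; rewrite -leqNgt; apply: subset_leq_card; apply/subsetP => b.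
  rewrite !inv_setE permM => /andP [bP ub]; rewrite bP /=.
  have ne : opp (u b) != a.
    apply: contraTneq gP => e; rewrite -(separates_opp _ sepP).
    by rewrite /g -e weyl_opp ?groupV // oppK permK.
  rewrite -(separates_opp _ sepP) in ub; have := refl_simple aS ub ne.
  by rewrite weyl_opp ?refl_weyl // (separates_opp _ sepP).
apply: proper_card; apply/properP; split.
  apply/subsetP => b; rewrite !inv_setE permM => /andP [bP]; rewrite bP /=.
  apply: contra => ub; apply: (refl_simple aS ub).
  by apply: contraNneq gP => e; rewrite /g -e permK.
exists (opp g);
  rewrite !inv_setE ?permM !(separates_opp _ sepP) gP weyl_opp // ug.
  by rewrite (separates_opp _ sepP) aP.
by rewrite /opp reflK aP.
Qed.

(** Transport by [u] takes the simple roots of [u^-1 P] to those of [P]; a descent [a] corresponds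
    to a wall [u^-1 a] outside [P]. *)
Lemma descentsE u : u \in weyl D ->
  descents D P u = #|simple_roots D (u @^-1: P) :&: ~: P|.
Proof.
move=> uW; rewrite simple_preim // /descents.
rewrite -(card_preimset _ (@perm_inj _ u)); apply: eq_card => b.
rewrite /left_descents 2!in_set [RHS]in_setI [in RHS]in_set in_setC.
by apply: andb_id2l => ubS; rewrite len_refl_simple // permK.
Qed.

Lemma w0_weyl : w0 D P \in weyl D.
Proof. by rewrite /w0; case: arg_maxnP => //; apply: group1. Qed.

(** Maximal length forces [w0^-1 a] to be negative for each simple [a]: otherwise [s_a w0] would be
    longer. Linearity extends this to all positive roots. *)
Lemma w0_preim : w0 D P @^-1: P = ~: P.
Proof.
have wW := w0_weyl.
have hS a : a \in simple -> ((w0 D P)^-1)%g a \notin P.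
  move=> aS; apply/negP => gP; pose w := wmul (refl D a) (w0 D P).
  have wW' : w \in weyl D by rewrite groupM ?refl_weyl.
  have := len_refl_simple wW' aS; rewrite invMg permM.
  have -> : ((refl D a)^-1)%g a = opp a.
    by apply: (canLR (permK _)); rewrite /opp reflK.
  rewrite weyl_opp ?groupV // (separates_opp _ sepP) gP.
  have -> : wmul (refl D a) w = w0 D P.
    by apply/permP => b; rewrite !permM reflK.
  have le_w : (len D P w <= len D P (w0 D P))%N.
    by rewrite /w0; case: arg_maxnP => [|v _]; [apply: group1|apply].
  by rewrite ltnNge le_w.
have hP b : b \in P -> ((w0 D P)^-1)%g b \notin P.
  have [M [hM _]] := weyl_linear (groupVr wW).
  move=> /(simple_decomp sepP) [s [sS es]].
  rewrite -(separates_pos _ sepP) -leNgt hM es mulmx_suml dot_suml big_seq.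
  apply: sumr_le0 => q /sS /hS; rewrite -hM -(separates_neg _ sepP).
  exact: ltW.
apply/setP => c; rewrite !inE; apply/idP/idP => [/hP|]; first by rewrite permK.
rewrite -(separates_opp _ sepP) => cP; apply: contraT.
rewrite -(separates_opp _ sepP) -weyl_opp // => /hP.
by rewrite permK cP.
Qed.

Lemma wdual_weyl w : w \in weyl D -> wdual D P w \in weyl D.
Proof. by move=> ww; rewrite groupM ?w0_weyl. Qed.

Lemma wdual_preim w : wdual D P w @^-1: P = ~: (w @^-1: P).
Proof.
by apply/setP => b; have /setP/(_ (w b)) := w0_preim; rewrite !inE permM.
Qed.

(** The walls of [w^-1 P] outside [P] count the descents of [w]. The dual has the opposite chamber,
    so its descents are the negatives of the walls lying in [P]; together these are all [n]
    walls. *)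
Lemma descents_wdual w : w \in weyl D ->
  (descents D P w + descents D P (wdual D P w) = n)%N.
Proof.
move=> ww; rewrite !descentsE ?wdual_weyl // wdual_preim.
have [l' h] := separates_preim ww sepP.
rewrite (simple_setC h) -[RHS](card_simple h) -[RHS](cardsID P) addnC.
congr (_ + _)%N; last by rewrite setDE.
rewrite -[RHS](card_preimset _ (can_inj oppK)); apply: eq_card => a.
rewrite in_setI in_setC [RHS]in_set in_setI (separates_opp _ sepP).
by rewrite in_set.
Qed.

End Descents.
End RootDatum.

Theorem corollary4 (n : nat) (I : finType) (D : semisimple_datum n I)
    (P : {set I}) (hP : positive_system D P)
    (w1 w2 w3 : {perm I})
    (hw1 : w1 \in weyl D) (hw2 : w2 \in weyl D) (hw3 : w3 \in weyl D)
    (hcover : P = inv_set D P (wdual D P w1) :|: inv_set D P (wdual D P w2)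
                    :|: inv_set D P (wdual D P w3))
    (hdisj12 : [disjoint inv_set D P (wdual D P w1)
                       & inv_set D P (wdual D P w2)])
    (hdisj13 : [disjoint inv_set D P (wdual D P w1)
                       & inv_set D P (wdual D P w3)])
    (hdisj23 : [disjoint inv_set D P (wdual D P w2)
                       & inv_set D P (wdual D P w3)]) :
  (descents D P w1 + descents D P w2 + descents D P w3 = 2 * n)%N /\
  (descents D P (wdual D P w1) + descents D P (wdual D P w2)
     + descents D P (wdual D P w3) = n)%N.
Proof.
have [l sepP] := positive_system_separates hP.
have d1 := descents_wdual sepP hw1; have d2 := descents_wdual sepP hw2.
have d3 := descents_wdual sepP hw3.
suff e : (descents D P (wdual D P w1) + descents D P (wdual D P w2)
     + descents D P (wdual D P w3) = n)%N by split=> //; lia.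
move: (wdual_weyl P hw1) (wdual_weyl P hw2) (wdual_weyl P hw3).
move: (wdual D P w1) (wdual D P w2) (wdual D P w3)
  hcover hdisj12 hdisj13 hdisj23.
move=> {w1 w2 w3 hw1 hw2 hw3 d1 d2 d3} u1 u2 u3 hcover h12 h13 h23 hu1 hu2 hu3.
(* After generalization the [u] are the duals. Index 0 is the opposite chamber, whose column sum
   counts their descents. *)
pose F (i : 'I_4) := nth (~: P) [:: ~: P; u1 @^-1: P; u2 @^-1: P; u3 @^-1: P] i.
have sepF i : exists l', separates D l' (F i).
  case: i => [[|[|[|[|//]]]]] ? /=; try exact: (separates_preim _ sepP).
  by exists (- l); apply: separates_setC.
(* A positive root is an inversion of exactly one of the three elements, so the other two keep it
   positive. *)
have twoP a : a \in P -> ((u1 a \in P) + (u2 a \in P) + (u3 a \in P) = 2)%N.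
  move=> aP; have := aP; rewrite {1}hcover !in_setU !(inv_setE sepP) aP /=.
  have excl u v : [disjoint inv_set D P u & inv_set D P v] ->
      (u a \in P) || (v a \in P).
    move=> /pred0P /(_ a) /=; rewrite !(inv_setE sepP) aP /=.
    by move/negbT; rewrite negb_and !negbK.
  have := excl _ _ h12; have := excl _ _ h13; have := excl _ _ h23.
  by case: (u1 a \in P); case: (u2 a \in P); case: (u3 a \in P).
have twoF a : (\sum_i (a \in F i) = 2)%N.
  rewrite !big_ord_recl big_ord0 /F /= !inE.
  have [aP|aP] := boolP (a \in P); first by have := twoP a aP; lia.
  rewrite -(separates_opp _ sepP) in aP; have := twoP _ aP.
  rewrite !weyl_opp // !(separates_opp _ sepP).
  by case: (u1 a \in P); case: (u2 a \in P); case: (u3 a \in P).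
have := card_walls sepF twoF ord0.
rewrite big_mkcond !big_ord_recl big_ord0 /F /= !(descentsE sepP) //.
by rewrite add0n addn0 addnA.
Qed.
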